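(* The class of tree-cographs is superrigid, that is, if $G$ is a tree-cograph and $H$ is any graph quantum isomorphic to $G$, then $H$ is isomorphic to $G$.
   Context: Graphs are finite, simple and undirected, with at least one vertex. The class of tree-cographs is the smallest class of graphs containing all trees and stable under finite disjoint unions and complement. A magic unitary with coefficients in a nonzero unital $C^*$-algebra $X$ is a square matrix whose entries are self-adjoint projections of $X$ with every row and column summing to $1_X$. Two graphs $G$ and $H$ with equally many vertices are quantum isomorphic if there is a magic unitary $U$, with coefficients in some nonzero unital $C^*$-algebra, rows indexed by $V(H)$ and columns by $V(G)$, with $U\,\mathrm{Adj}(G)=\mathrm{Adj}(H)\,U$ ($\mathrm{Adj}$ = adjacency matrix). *)

(* Defs.v *)
From HB Require Import structures.
From mathcomp Require Import all_boot all_order all_algebra.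
From mathcomp Require Import reals complex.

Set Implicit Arguments.
Unset Strict Implicit.
Unset Printing Implicit Defensive.

Import Order.TTheory GRing.Theory Num.Theory.
Local Open Scope ring_scope.
Local Open Scope complex_scope.

Record graph := Graph {
  vertex :> finType;
  edge : rel vertex;
  edge_sym : symmetric edge;
  edge_irr : irreflexive edge;
  vertex_gt0 : (0 < #|vertex|)%N
}.
Arguments edge : clear implicits.

Definition isomorphic (G H : graph) : Prop :=
  exists2 f : G -> H, bijective f & forall x y : G, edge H (f x) (f y) = edge G x y.

Definition connected (G : graph) : Prop :=
  forall x y : G, connect (edge G) x y.

(* The bound on the length excludes the closed walk x, y, x along one edge. *)
Definition acyclic (G : graph) : Prop :=
  forall c : seq G, ucycle (edge G) c -> (size c <= 2)%N.

Definition is_tree (G : graph) : Prop := connected G /\ acyclic G.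

Section Complement.
Variable G : graph.

Definition compl_edge : rel G := fun x y => (x != y) && ~~ edge G x y.

Lemma compl_edge_sym : symmetric compl_edge.
Proof. by move=> x y; rewrite /compl_edge eq_sym edge_sym. Qed.

Lemma compl_edge_irr : irreflexive compl_edge.
Proof. by move=> x; rewrite /compl_edge eqxx. Qed.

Definition complement : graph :=
  Graph compl_edge_sym compl_edge_irr (vertex_gt0 G).
End Complement.

Section DisjointUnion.
Variables (I : finType) (F : I -> graph) (I_gt0 : (0 < #|I|)%N).

Definition du_vertex : finType := {i : I & vertex (F i)}.

Definition du_edge : rel du_vertex := fun u v =>
  (tag u == tag v) && edge (F (tag u)) (tagged u) (tagged_as u v).

Lemma du_edge_sym : symmetric du_edge.
Proof.
move=> [i x] [j y]; rewrite /du_edge /= eq_sym; case: eqP => //= ij.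
by case: _ / ij x => x; rewrite !tagged_asE edge_sym.
Qed.

Lemma du_edge_irr : irreflexive du_edge.
Proof. by move=> [i x]; rewrite /du_edge tagged_asE edge_irr andbF. Qed.

Lemma du_vertex_gt0 : (0 < #|du_vertex|)%N.
Proof.
have /card_gt0P[i _] := I_gt0; have /card_gt0P[x _] := vertex_gt0 (F i).
by apply/card_gt0P; exists (Tagged (fun i => vertex (F i)) x).
Qed.

Definition disjoint_union : graph := Graph du_edge_sym du_edge_irr du_vertex_gt0.
End DisjointUnion.

(* Classes of graphs are closed under isomorphism, hence the last clause. *)
Inductive tree_cograph : graph -> Prop :=
| TreeCographTree (G : graph) : is_tree G -> tree_cograph G
| TreeCographUnion (I : finType) (F : I -> graph) (I_gt0 : (0 < #|I|)%N) :
    (forall i, tree_cograph (F i)) -> tree_cograph (disjoint_union F I_gt0)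
| TreeCographCompl (G : graph) : tree_cograph G -> tree_cograph (complement G)
| TreeCographIso (G H : graph) :
    isomorphic G H -> tree_cograph G -> tree_cograph H.

(* Unital C*-algebras. An algType is nontrivial (1 != 0), so these are the      *)
(* nonzero ones. The norm is a field of the mixin, rather than inherited from   *)
(* completeNormedModType: Hierarchy-Builder rejects a structure joining         *)
(* normed modules with possibly noncommutative rings because such a join was    *)
(* not declared below numDomainType.                                            *)
HB.mixin Record isCStarAlgebra (R : realType) (A : Type) of
    GRing.Algebra R[i] A := {
  star : A -> A;
  starK : involutive star;
  starD : {morph star : x y / x + y};
  starZ : forall (c : R[i]) (x : A), star (c *: x) = c^* *: star x;
  starM : forall x y : A, star (x * y) = star y * star x;
  cnorm : A -> R;
  cnorm_eq0 : forall x : A, cnorm x = 0 -> x = 0;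
  cnorm_triangle : forall x y : A, cnorm (x + y) <= cnorm x + cnorm y;
  cnormZ : forall (c : R[i]) (x : A),
    cnorm (c *: x) = ComplexField.Normc.normc c * cnorm x;
  cnormM_le : forall x y : A, cnorm (x * y) <= cnorm x * cnorm y;
  cnorm_star_mul : forall x : A, cnorm (star x * x) = cnorm x ^+ 2;
  cnorm_complete : forall u : nat -> A,
    (forall e : R, 0 < e -> exists N : nat, forall m n : nat,
       (N <= m)%N -> (N <= n)%N -> cnorm (u m - u n) < e) ->
    exists l : A, forall e : R, 0 < e -> exists N : nat, forall n : nat,
       (N <= n)%N -> cnorm (u n - l) < e
}.

#[short(type="cstarAlgType")]
HB.structure Definition CStarAlgebra (R : realType) :=
  {A of isCStarAlgebra R A & GRing.Algebra R[i] A}.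

Section QuantumIsomorphism.
Variable R : realType.

Definition is_projection (A : cstarAlgType R) (p : A) : Prop :=
  star p = p /\ p * p = p.

(* Matrices with rows indexed by S and columns by T are functions S -> T -> A. *)
Definition magic_unitary (A : cstarAlgType R) (S T : finType)
    (U : S -> T -> A) : Prop :=
  [/\ #|S| = #|T|,
      forall x y, is_projection (U x y),
      forall x, \sum_(y : T) U x y = 1
    & forall y, \sum_(x : S) U x y = 1].

Definition adj (A : cstarAlgType R) (G : graph) : G -> G -> A :=
  fun x y => (edge G x y)%:R.

Definition matmul (A : cstarAlgType R) (S T W : finType)
    (M : S -> T -> A) (N : T -> W -> A) : S -> W -> A :=
  fun x z => \sum_(y : T) M x y * N y z.

Definition quantum_isomorphic (G H : graph) : Prop :=
  #|G| = #|H| /\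
  exists (A : cstarAlgType R) (U : H -> G -> A),
    magic_unitary U /\ matmul U (@adj A G) =2 matmul (@adj A H) U.

Definition superrigid (C : graph -> Prop) : Prop :=
  forall G H : graph, C G -> quantum_isomorphic G H -> isomorphic H G.

End QuantumIsomorphism.

(* Main.v *)
Require Import Defs.
From mathcomp Require Import all_boot all_order all_algebra.
From mathcomp Require Import boolp reals complex ring lra.

Set Implicit Arguments.
Unset Strict Implicit.
Unset Printing Implicit Defensive.

Import Order.TTheory GRing.Theory Num.Theory.
Local Open Scope ring_scope.
Local Open Scope complex_scope.

(* Projections summing to 1 in a C*-algebra are pairwise orthogonal, so the     *)
(* relation U y x * U y' x' != 0 between pairs of vertices preserves equality,  *)
(* adjacency and, inductively, every count of vertices by their relations to    *)
(* the pair. This is a winning strategy in the bijective three-pebble game on G *)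
(* and H (equivalence under 2-dimensional Weisfeiler-Leman refinement), and the *)
(* rest is combinatorial: such strategies restrict to connected components and  *)
(* pass to complements, and a component count reduces the claim to a connected  *)
(* graph. If that graph is a tree, unfolding the strategy along the tree gives  *)
(* a covering map onto H, bijective because both have as many vertices.         *)
(* The induction proves the claim for all induced subgraphs of a tree-cograph,  *)
(* which makes the components of a disjoint union available.                    *)

(** * Norms and projections in a C*-algebra *)

(** The analytic input is [projection_sum_orthogonal]. It follows from extremality of the unit in
    the unit ball of a corner ([cnorm_extreme]), which rests on norm inequalities between
    polynomials in one self-adjoint element ([cnorm_dilate_le1]). Orthogonality turns [U M = N U],
    for 0-1 matrices, into the entrywise condition [matched]. Intertwining survives matrix products,
    so numbers of two-step paths are matched too ([matched_count]), and counting yields the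
    bijections that [quantum_strategy] plays. It remains to show that tree-cographs are [rigid],
    that is, determined by the game: [tree_rigid] treats trees, [rigid_components] and
    [rigid_complement] the two operations, and [tree_cograph_embeds_rigid] runs the induction. *)

Section CStarNorm.
Variables (R : realType) (A : cstarAlgType R).
Implicit Types (x y p : A).

(* The mixin lemmas mention unfolded instances that defeat keyed rewriting;    *)
(* the next statements are the same facts over the canonical instances.        *)
Lemma star_mul x y : star (x * y) = star y * star x.
Proof. exact: starM. Qed.

Lemma star_add x y : star (x + y) = star x + star y.
Proof. exact: starD. Qed.

Lemma star_scale (c : R[i]) x : star (c *: x) = c^* *: star x.
Proof. exact: starZ. Qed.

Lemma cnorm_scale (c : R[i]) x :
  cnorm (c *: x) = ComplexField.Normc.normc c * cnorm x.
Proof. exact: cnormZ. Qed.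

Lemma cnorm_add x y : cnorm (x + y) <= cnorm x + cnorm y.
Proof. exact: cnorm_triangle. Qed.

Lemma cnorm_mul x y : cnorm (x * y) <= cnorm x * cnorm y.
Proof. exact: cnormM_le. Qed.

Lemma cnorm_star_square x : cnorm (star x * x) = cnorm x ^+ 2.
Proof. exact: cnorm_star_mul. Qed.

Lemma cnorm0 : cnorm (0 : A) = 0.
Proof.
rewrite -[0 : A](scale0r 0) cnorm_scale /ComplexField.Normc.normc /=.
by rewrite expr0n addr0 sqrtr0 mul0r.
Qed.

Lemma cnormMn x n : cnorm (x *+ n) = cnorm x *+ n.
Proof.
rewrite -scaler_nat cnorm_scale -[RHS]mulr_natl; congr (_ * _).
by rewrite -(rmorph_nat (real_complex R)) /= expr0n /= addr0 sqrtr_sqr ger0_norm.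
Qed.

Lemma cnormN x : cnorm (- x) = cnorm x.
Proof.
rewrite -scaleN1r cnorm_scale -(rmorphN1 (real_complex R)) /=.
by rewrite expr0n /= addr0 sqrtr_sqr normrN1 mul1r.
Qed.

Lemma cnorm_ge0 x : 0 <= cnorm x.
Proof.
have := cnorm_add x (- x); rewrite subrr cnorm0 cnormN => h; lra.
Qed.

Lemma cnormM_le1 x y : cnorm x <= 1 -> cnorm y <= 1 -> cnorm (x * y) <= 1.
Proof.
by move=> x1 y1; apply: le_trans (cnorm_mul _ _) _; apply: mulr_ile1; rewrite ?cnorm_ge0.
Qed.

Lemma cnorm_le1_star_mul x : cnorm (star x * x) <= 1 -> cnorm x <= 1.
Proof. by rewrite cnorm_star_square expr_le1 ?cnorm_ge0. Qed.

Lemma cnorm_sum (I : Type) (r : seq I) (P : pred I) (F : I -> A) :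
  cnorm (\sum_(i <- r | P i) F i) <= \sum_(i <- r | P i) cnorm (F i).
Proof.
elim/big_rec2: _ => [|i y x _ le]; first by rewrite cnorm0.
by apply: le_trans (cnorm_add _ _) _; rewrite lerD2l.
Qed.

Lemma star1 : star (1 : A) = 1.
Proof. by have := star_mul (star (1 : A)) 1; rewrite mulr1 starK mulr1. Qed.

Lemma starMn x n : star (x *+ n) = star x *+ n.
Proof.
rewrite -(scaler_nat n x) -(scaler_nat n (star x)) star_scale; congr (_ *: _).
exact: rmorph_nat.
Qed.

Lemma star0 : star (0 : A) = 0.
Proof. by rewrite -(mulr0n 1) starMn. Qed.

Lemma starN x : star (- x) = - star x.
Proof.
rewrite -(scaleN1r x) -(scaleN1r (star x)) star_scale; congr (_ *: _).
exact: rmorphN1.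
Qed.

Lemma projection_cnorm_le1 p : is_projection p -> cnorm p <= 1.
Proof.
move=> [sp pp]; have := cnorm_star_square p; rewrite sp pp.
have := cnorm_ge0 p => h e; nra.
Qed.

Lemma projection1 : is_projection (1 : A).
Proof. by split; rewrite ?star1 ?mulr1. Qed.

End CStarNorm.

(** * Extremality of the unit of a corner *)

Section Extreme.
(* The projection e plays the role of the unit of the corner e A e.             *)
Variables (R : realType) (A : cstarAlgType R) (e : A).
Hypothesis e_proj : is_projection e.

Let ee : e * e = e := proj2 e_proj.
Let se : star e = e := proj1 e_proj.

Section Evaluation.
Variable a : A.
Hypotheses (ea : e * a = a) (ae : a * e = a) (sa : star a = a).

(** Polynomial calculus in the corner, constants becoming multiples of [e]: identities that [ring]
    proves for commuting polynomials transfer to [A]. *)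
Definition corner_eval (q : {poly R[i]}) : A := e * horner_alg a q.

Lemma corner_evalD q r : corner_eval (q + r) = corner_eval q + corner_eval r.
Proof. by rewrite /corner_eval rmorphD mulrDr. Qed.

Lemma corner_evalN q : corner_eval (- q) = - corner_eval q.
Proof. by rewrite /corner_eval rmorphN mulrN. Qed.

Lemma corner_evalMn q n : corner_eval (q *+ n) = corner_eval q *+ n.
Proof. by rewrite /corner_eval rmorphMn mulrnAr. Qed.

Lemma corner_evalM q r : corner_eval (q * r) = corner_eval q * corner_eval r.
Proof.
have comm : horner_alg a q * e = e * horner_alg a q.
  elim/poly_ind: q => [|q c IH]; first by rewrite rmorph0 mul0r mulr0.
  rewrite rmorphD rmorphM /= horner_algX horner_algC mulrDl mulrDr.
  by rewrite [in RHS]mulrA -IH -!mulrA ae ea -scalerAl -scalerAr mul1r mulr1.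
by rewrite /corner_eval rmorphM /= -[in RHS]mulrA (mulrA _ e) comm !mulrA ee.
Qed.

Lemma corner_eval1 : corner_eval 1 = e.
Proof. by rewrite /corner_eval rmorph1 mulr1. Qed.

Lemma corner_evalX : corner_eval 'X = a.
Proof. by rewrite /corner_eval horner_algX. Qed.

Let bounded (q : {poly R[i]}) (n : nat) := cnorm (corner_eval q) <= n%:R.

Let bounded1 : bounded 1 1.
Proof. by rewrite /bounded corner_eval1 projection_cnorm_le1. Qed.

Let boundedD q r m n : bounded q m -> bounded r n -> bounded (q + r) (m + n).
Proof.
rewrite /bounded corner_evalD natrD => qm rn.
by rewrite (le_trans (cnorm_add _ _)) // lerD.
Qed.

Let boundedM q r m n : bounded q m -> bounded r n -> bounded (q * r) (m * n).
Proof.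
rewrite /bounded corner_evalM natrM => qm rn.
by rewrite (le_trans (cnorm_mul _ _)) // ler_pM ?cnorm_ge0.
Qed.

Let boundedX q m k : bounded q m -> bounded (q ^+ k) (m ^ k).
Proof. by move=> qm; elim: k => // k IH; rewrite exprS expnS boundedM. Qed.

Let boundedMn q m k : bounded q m -> bounded (q *+ k) (m * k).
Proof.
by rewrite /bounded corner_evalMn cnormMn natrM mulr_natr => qm; rewrite lerMn2r qm orbT.
Qed.

Let bounded_div q m k : (0 < k)%N -> bounded (q *+ k) (m * k) -> bounded q m.
Proof.
by rewrite /bounded corner_evalMn cnormMn natrM mulr_natr lerMn2r; case: k.
Qed.

Hypotheses (aP : cnorm (e + a) <= 1) (aN : cnorm (e - a) <= 1).

Let bP : bounded (1 + 'X) 1.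
Proof. by rewrite /bounded corner_evalD corner_eval1 corner_evalX. Qed.

Let bN : bounded (1 - 'X) 1.
Proof. by rewrite /bounded corner_evalD corner_evalN corner_eval1 corner_evalX. Qed.

Let bS : bounded (1 + 'X ^+ 2 *+ 3) 1.
Proof.
apply: (@bounded_div _ _ 4) => //.
have -> : (1 + 'X ^+ 2 *+ 3) *+ 4 = (1 + 'X) ^+ 4 + (1 - 'X) ^+ 4
    + ((1 + 'X) * (1 - 'X) * ((1 + 'X) ^+ 2 + (1 - 'X) ^+ 2)) :> {poly R[i]}.
  by ring.
exact: (boundedD (boundedD (boundedX 4 bP) (boundedX 4 bN))
  (boundedM (boundedM bP bN) (boundedD (boundedX 2 bP) (boundedX 2 bN)))).
Qed.

(** The C*-identity at work: the adjoint of [w] times [w] is 4 + 9 X^2 = 3 (1 + 3 X^2) + 1, of norm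
    at most 4. *)
Let bI (c : R[i]) : c ^+ 2 = -1 -> (c^*)%R = - c -> bounded (1 *+ 2 + (c%:P * 'X) *+ 3) 2.
Proof.
move=> c2 cc; set w := 1 *+ 2 + _.
have evcX d : corner_eval (d%:P * 'X) = d *: a.
  by rewrite /corner_eval rmorphM /= horner_algC horner_algX -scalerAl mul1r -scalerAr ea.
have sw : star (corner_eval w) = corner_eval (1 *+ 2 - (c%:P * 'X) *+ 3).
  rewrite !(corner_evalD, corner_evalN, corner_evalMn, corner_eval1) evcX.
  by rewrite !star_add !star_scale se sa cc !scaleNr -!opprD.
rewrite /bounded -(@ler_pXn2r _ 2) ?nnegrE ?cnorm_ge0 ?ler0n //.
rewrite -cnorm_star_square sw -corner_evalM.
have -> : (1 *+ 2 - (c%:P * 'X) *+ 3) * w = (1 + 'X ^+ 2 *+ 3) *+ 3 + 1.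
  rewrite /w; have : c%:P ^+ 2 = -1 :> {poly R[i]} by rewrite -polyC_exp c2 polyCN.
  move=> h; ring: h.
by rewrite -natrX; apply: (boundedD (boundedMn 3 bS) bounded1).
Qed.

Let bT : bounded (1 *+ 4 - 'X ^+ 2 *+ 9) 4.
Proof.
apply: (@bounded_div _ _ 2) => //.
have i2 : ('i%C : R[i]) ^+ 2 = -1 by rewrite sqr_i.
have ic : (('i%C : R[i])^*)%R = - 'i%C by apply/eqP; rewrite eq_complex /= oppr0 !eqxx.
have b1 := bI i2 ic.
have b2 : bounded (1 *+ 2 + ((- 'i%C)%:P * 'X) *+ 3) 2.
  by apply: bI; rewrite ?sqrrN // rmorphN /= ic.
have := boundedD (boundedX 2 b1) (boundedX 2 b2).
congr bounded.
have h : 'i%C%:P ^+ 2 = -1 :> {poly R[i]} by rewrite -polyC_exp i2 polyCN.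
rewrite polyCN; ring: h.
Qed.

(* Products and weighted means of contractions are contractions, and so is x    *)
(* when x^* x is: the identities above and below are such certificates, found   *)
(* by linear programming, for the dilation factor 9/8 > 1.                      *)
Lemma cnorm_dilate_le1 : cnorm (e + (9 / 8 : R)%:C *: a) <= 1.
Proof.
(* As 8 e + 9 a is self-adjoint, it suffices to bound its square. The weights add up: 296 * 4 + 2247
   + 7 + 146 = 56 * 64. *)
have b : bounded ((1 *+ 8 + 'X *+ 9) ^+ 2) (8 ^ 2).
  apply: (@bounded_div _ _ 56) => //.
  have -> : (1 *+ 8 + 'X *+ 9) ^+ 2 *+ 56 =
      ((1 + 'X) * (1 *+ 4 - 'X ^+ 2 *+ 9)) *+ 296 + (1 + 'X) ^+ 3 *+ 2247
      + ((1 - 'X) * (1 + 'X ^+ 2 *+ 3)) *+ 7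
      + ((1 + 'X) * (1 + 'X ^+ 2 *+ 3)) *+ 146 :> {poly R[i]} by ring.
  exact: (boundedD (boundedD (boundedD (boundedMn 296 (boundedM bP bT))
    (boundedMn 2247 (boundedX 3 bP))) (boundedMn 7 (boundedM bN bS)))
    (boundedMn 146 (boundedM bP bS))).
have -> : e + (9 / 8 : R)%:C *: a = (8^-1 : R)%:C *: (e *+ 8 + a *+ 9).
  rewrite -(scaler_nat 8 e) -(scaler_nat 9 a) scalerDr !scalerA.
  rewrite -!(rmorph_nat (real_complex R)) -!rmorphM /=.
  by rewrite mulVf ?pnatr_eq0 // scale1r mulrC.
have x_ev : e *+ 8 + a *+ 9 = corner_eval (1 *+ 8 + 'X *+ 9).
  by rewrite corner_evalD !corner_evalMn corner_eval1 corner_evalX.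
have sx : star (e *+ 8 + a *+ 9) = e *+ 8 + a *+ 9 by rewrite star_add !starMn se sa.
rewrite cnorm_scale /= expr0n /= addr0 sqrtr_sqr ger0_norm ?invr_ge0 ?ler0n //.
rewrite ler_pdivrMl ?ltr0n // mulr1 -(@ler_pXn2r _ 2) ?nnegrE ?cnorm_ge0 ?ler0n //.
by rewrite -cnorm_star_square sx x_ev -corner_evalM -natrX.
Qed.
End Evaluation.

(** Dilation by 9/8 preserves the hypotheses, being applicable to [a] and [- a]; at the end 2 a = (e
    + a) - (e - a) bounds the norm. *)
Lemma cnorm_geometric_le1 n (a : A) : e * a = a -> a * e = a -> star a = a ->
  cnorm (e + a) <= 1 -> cnorm (e - a) <= 1 -> (9 / 8) ^+ n * cnorm a <= 1.
Proof.
elim: n a => [|n IH] a ea ae sa aP aN.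
  have := cnorm_add (e + a) (- (e - a)); rewrite cnormN opprB addrC addrA addrNK.
  rewrite -mulr2n cnormMn mul1r => h; lra.
have ea' : e * - a = - a by rewrite mulrN ea.
have ae' : - a * e = - a by rewrite mulNr ae.
have sa' : star (- a) = - a by rewrite starN sa.
have aN' : cnorm (e - - a) <= 1 by rewrite opprK.
have := IH ((9 / 8 : R)%:C *: a); rewrite cnorm_scale /= expr0n /= addr0 sqrtr_sqr.
rewrite ger0_norm ?divr_ge0 ?ler0n // mulrA -exprSr; apply.
- by rewrite -scalerAr ea.
- by rewrite -scalerAl ae.
- by rewrite star_scale sa; congr (_ *: _); apply: conjc_real.
- exact: cnorm_dilate_le1.
- by rewrite -scalerN; apply: cnorm_dilate_le1.
Qed.

(* The unit is an extreme point of the unit ball: dilating a repeatedly keeps   *)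
(* e + a and e - a in the ball.                                                 *)
Lemma cnorm_extreme (a : A) : e * a = a -> a * e = a -> star a = a ->
  cnorm (e + a) <= 1 -> cnorm (e - a) <= 1 -> a = 0.
Proof.
move=> ea ae sa aP aN; apply: cnorm_eq0; apply/eqP; rewrite eq_le cnorm_ge0 andbT.
rewrite leNgt; apply/negP => a0.
have lt2 := upper_nthrootP (leqnn (Num.bound (cnorm a)^-1)).
move: lt2; set i := Num.bound _ => lt2.
(* (9/8)^6 > 2: six dilations at least double the norm. *)
have le2 : 2 ^+ i <= (9 / 8) ^+ (6 * i) :> R.
  by rewrite exprM lerXn2r ?nnegrE ?exprn_ge0 //; lra.
have := cnorm_geometric_le1 (6 * i) ea ae sa aP aN; apply/negP; rewrite -ltNge.
by rewrite -ltr_pdivrMr // div1r; apply: lt_le_trans lt2 le2.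
Qed.
End Extreme.

Section Orthogonality.
Variables (R : realType) (A : cstarAlgType R).

(* In the corner at e = p j, the reflections 1 - 2 p k with k != j compress to  *)
(* contractions whose mean is e, so each of them is e by extremality.           *)
Lemma projection_sum_orthogonal (I : finType) (p : I -> A) :
  (forall i, is_projection (p i)) -> \sum_i p i = 1 ->
  forall i j, i != j -> p i * p j = 0.
Proof.
move=> p_proj p_sum i j ij.
have sp k : star (p k) = p k by case: (p_proj k).
have pp k : p k * p k = p k by case: (p_proj k).
set e := p j; pose b k := (e * p k * e) *+ 2.
have eb k : e * b k = b k by rewrite /b mulrnAr !mulrA pp.
have be k : b k * e = b k by rewrite /b mulrnAl -!mulrA pp.
have sb k : star (b k) = b k by rewrite /b starMn !star_mul !sp mulrA.
have b_le1 k : cnorm (e - b k) <= 1.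
  have -> : e - b k = e * (1 - p k *+ 2) * e.
    by rewrite mulrBr mulrBl mulr1 pp mulrnAr mulrnAl.
  have e1 : cnorm e <= 1 := projection_cnorm_le1 (p_proj j).
  (* The reflection [1 - p k *+ 2] is self-adjoint with square 1. *)
  apply: cnormM_le1 (e1); apply: cnormM_le1 (e1) _; apply: cnorm_le1_star_mul.
  rewrite star_add starN starMn star1 sp mulr2n.
  rewrite mulrBr mulr1 mulrBl mul1r mulrDl !mulrDr pp.
  rewrite [in X in _ - X]opprD [in X in _ - X]addrA subrr sub0r opprK subrK.
  exact: projection_cnorm_le1 (projection1 A).
have b_sum : \sum_(k | k != j) b k = 0.
  rewrite sumrMnl -mulr_suml -mulr_sumr.
  have := congr1 (fun x => e * x * e) p_sum; rewrite (bigD1 j) //= mulrDr mulrDl.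
  by rewrite mulr1 !pp -[RHS]addr0 => /addrI ->; rewrite mul0rn.
pose m := #|[pred k | (k != j) && (k != i)]|.
(* By [b_sum], [b i] is minus the sum of the other [b k]; hence [e *+ m.+1 + b i] and
   [e *+ m.+1 - b i] are both sums of [m.+1] contractions. *)
have e_sum : e *+ m.+1 + b i = e + \sum_(k | (k != j) && (k != i)) (e - b k).
  rewrite big_split /= sumr_const -/m sumrN mulrS -!addrA; congr (_ + (_ + _)).
  by move: b_sum; rewrite (bigD1 i) //= => /eqP; rewrite addr_eq0 => /eqP.
have cone n : cnorm (e *+ n) <= n%:R.
  by rewrite cnormMn lerMn2r; apply/orP; right; apply: projection_cnorm_le1 (p_proj j).
have bP : cnorm (e *+ m.+1 + b i) <= m.+1%:R.
  rewrite e_sum -natr1 addrC (le_trans (cnorm_add _ _)) //.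
  rewrite lerD ?(projection_cnorm_le1 (p_proj j)) //.
  rewrite (le_trans (cnorm_sum _ _ _)) //.
  by rewrite /m -sumr_const ler_sum.
have bN : cnorm (e *+ m.+1 - b i) <= m.+1%:R.
  by rewrite mulrSr -addrA -natr1 (le_trans (cnorm_add _ _)) // lerD.
have m_scale x : cnorm (e *+ m.+1 + x) <= m.+1%:R ->
    cnorm (e + (m.+1%:R^-1 : R)%:C *: x) <= 1.
  have -> : e + (m.+1%:R^-1 : R)%:C *: x = (m.+1%:R^-1 : R)%:C *: (e *+ m.+1 + x).
    rewrite scalerDr -(scaler_nat m.+1 e) scalerA.
    rewrite -(rmorph_nat (real_complex R)) -rmorphM /=.
    by rewrite mulVf ?pnatr_eq0 // scale1r.
  rewrite cnorm_scale /= expr0n /= addr0 sqrtr_sqr ger0_norm ?invr_ge0 ?ler0n //.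
  by rewrite ler_pdivrMl ?ltr0n // mulr1.
have b0 : b i = 0.
  have : (m.+1%:R^-1 : R)%:C *: b i = 0.
    apply: (cnorm_extreme (p_proj j)); rewrite -?scalerAr -?scalerAl ?eb ?be ?m_scale //.
      by rewrite star_scale sb; congr (_ *: _); apply: conjc_real.
    by rewrite -scalerN m_scale.
  move/eqP; rewrite scaler_eq0 => /orP[|/eqP//].
  by rewrite fmorph_eq0 invr_eq0 pnatr_eq0.
(* [p j * p i * p j] is [star x * x] for [x = p i * p j]. *)
apply: cnorm_eq0; apply/eqP; rewrite -sqrf_eq0 -cnorm_star_square star_mul !sp.
rewrite mulrA -(mulrA (p j)) pp.
move: b0; rewrite /b -scaler_nat => /eqP; rewrite scaler_eq0 pnatr_eq0 /=.
by move=> /eqP ->; rewrite cnorm0.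
Qed.
End Orthogonality.

(** * From magic unitaries to strategies in the pebble game *)

Section FiberBijection.

(** Elements of corresponding fibers are paired by rank; [t0] is only the default of [nth]. *)
Lemma fiber_injection (S T : finType) (K : eqType) (f : S -> K) (h : T -> K)
    (t0 : T) :
  (forall k, (#|[pred s | f s == k]| <= #|[pred t | h t == k]|)%N) ->
  exists2 g : S -> T, injective g & forall s, h (g s) = f s.
Proof.
move=> le; pose g s :=
  nth t0 (enum [pred t | h t == f s]) (index s (enum [pred s' | f s' == f s])).
have lt s : (index s (enum [pred s' | f s' == f s])
    < size (enum [pred t | h t == f s]))%N.
  by rewrite -cardE; apply: leq_trans (le _); rewrite cardE index_mem mem_enum inE.
have hg s : h (g s) = f s.
  by have := mem_nth t0 (lt s); rewrite mem_enum inE => /eqP.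
exists g => // s s' gs; have fs : f s' = f s by rewrite -!hg gs.
move/eqP: gs; rewrite /g fs nth_uniq ?enum_uniq //; last first.
  by have := lt s'; rewrite fs.
move=> /eqP eq_index; have := congr1 (nth s (enum [pred x | f x == f s])) eq_index.
by rewrite !nth_index // mem_enum inE ?fs.
Qed.

Lemma fiber_bijection (S T : finType) (K : eqType) (f : S -> K) (h : T -> K)
    (s0 : S) (t0 : T) :
  (forall k, #|[pred s | f s == k]| = #|[pred t | h t == k]|) ->
  exists2 g : S -> T, bijective g & forall s, h (g s) = f s.
Proof.
move=> eq_fibers; have [|g g_inj hg] := @fiber_injection S T K f h t0.
  by move=> k; rewrite eq_fibers.
have [|g' g'_inj _] := @fiber_injection T S K h f s0.
  by move=> k; rewrite eq_fibers.
by exists g => //; apply: inj_card_bij g_inj _; apply: leq_card g'_inj.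
Qed.

End FiberBijection.

(* A winning strategy in the bijective three-pebble game: rho x x' y y' holds   *)
(* in the winning positions with x, x' in G facing y, y' in H, and g gives the  *)
(* answer g z to a third pebble on z, after which either old pebble is lifted.  *)
Record strategy (G H : graph) (rho : G -> G -> H -> H -> Prop) : Prop := Strategy {
  strategy_eq : forall x x' y y', rho x x' y y' -> (x == x') = (y == y');
  strategy_edge : forall x x' y y', rho x x' y y' -> edge G x x' = edge H y y';
  strategy_swap : forall x x' y y', rho x x' y y' -> rho x' x y' y;
  strategy_move : forall x x' y y', rho x x' y y' ->
    exists2 g : G -> H, bijective g &
      forall z, rho x z y (g z) /\ rho z x' (g z) y';
  strategy_start : exists x y, rho x x y y
}.

Definition pebble_equivalent (G H : graph) : Prop :=
  exists rho : G -> G -> H -> H -> Prop, strategy rho.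

Section QuantumStrategy.
Variables (R : realType) (A : cstarAlgType R) (G H : graph) (U : H -> G -> A).
Hypotheses (U_magic : magic_unitary U).
Hypothesis U_adj : matmul U (@adj R A G) =2 matmul (@adj R A H) U.

Let U_proj y x : is_projection (U y x). Proof. by case: U_magic. Qed.
Let U_row y : \sum_x U y x = 1. Proof. by case: U_magic. Qed.
Let U_col x : \sum_y U y x = 1. Proof. by case: U_magic. Qed.

Let U_idem y x : U y x * U y x = U y x. Proof. by case: (U_proj y x). Qed.

Let U_row_orth y x x' : x != x' -> U y x * U y x' = 0.
Proof. exact: projection_sum_orthogonal. Qed.

Let U_col_orth x y y' : y != y' -> U y x * U y' x = 0.
Proof. exact: (@projection_sum_orthogonal _ _ _ (U^~ x)). Qed.

Definition matched (W : Type) (f : G -> G -> W) (h : H -> H -> W) : Prop :=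
  forall x x' y y', U y x * U y' x' != 0 -> f x x' = h y y'.

(** Multiplying by [U y x] on the left and [U y' x'] on the right kills all but one term on each
    side, leaving two multiples of the same nonzero element. *)
Lemma intertwined_matched (f : G -> G -> nat) (h : H -> H -> nat) :
  (forall y x, \sum_x' U y x' *+ f x' x = \sum_y' U y' x *+ h y y') -> matched f h.
Proof.
move=> fh x x' y y' nz.
have := congr1 (fun a => U y x * a * U y' x') (fh y x').
rewrite !mulr_sumr !mulr_suml (bigD1 x) //= (bigD1 y') //= !big1 => [|y2 ne|x2 ne].
- rewrite !addr0 !mulrnAr !mulrnAl U_idem -mulrA U_idem => /eqP.
  rewrite -(scaler_nat (f x x')) -(scaler_nat (h y y')) -subr_eq0.
  rewrite -scalerBl scaler_eq0 (negPf nz) orbF subr_eq0.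
  by rewrite eqr_nat => /eqP.
- by rewrite mulrnAr mulrnAl -mulrA U_col_orth ?mulr0 ?mul0rn.
- by rewrite mulrnAr U_row_orth ?mul0rn ?mul0r // eq_sym.
Qed.

(** Inserting a column sum on the left and a row sum on the right expands both sides into the same
    products, which vanish unless the conditions agree. *)
Lemma matched_intertwined (f : G -> G -> bool) (h : H -> H -> bool) y x :
  matched f h -> \sum_(x' | f x' x) U y x' = \sum_(y' | h y y') U y' x.
Proof.
move=> fh.
transitivity (\sum_x' \sum_y' (if f x' x then U y x' * U y' x else 0)).
  rewrite big_mkcond; apply: eq_bigr => x' _; case: ifP => _; last by rewrite big1.
  by rewrite -mulr_sumr U_col mulr1.
rewrite exchange_big [RHS]big_mkcond; apply: eq_bigr => y' _ /=.
transitivity (\sum_x' (if h y y' then U y x' * U y' x else 0)).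
  apply: eq_bigr => x' _; have [->|nz] := eqVneq (U y x' * U y' x) 0.
    by rewrite !if_same.
  by rewrite (fh _ _ _ _ nz).
by case: ifP => _; [rewrite -mulr_suml U_row mul1r | rewrite big1].
Qed.

(** The counts are entries of a product of two 0-1 matrices; [U] passes the factors one at a
    time. *)
Lemma matched_count (W : eqType) (f : G -> G -> W) (h : H -> H -> W) (r s : W) :
  matched f h ->
  matched (fun x x' => #|[pred z | (f x z == r) && (f z x' == s)]|)
          (fun y y' => #|[pred z | (h y z == r) && (h z y' == s)]|).
Proof.
move=> fh; apply: intertwined_matched => y x.
have fhb t : matched (fun u v => f u v == t) (fun u v => h u v == t).
  by move=> u u' v v' /fh ->.
have count_sum (I : finType) (P Q : I -> pred I) (F : I -> A) :
    \sum_u F u *+ #|[pred z | P u z && Q u z]| = \sum_z \sum_(u | P u z && Q u z) F u.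
  rewrite (exchange_big_dep xpredT) //=; apply: eq_bigr => u _.
  by rewrite sumr_const.
rewrite (count_sum _ (fun u z => f u z == r) (fun u z => f z x == s)).
rewrite [RHS](_ : _ = \sum_(z | h y z == r) \sum_(y' | h z y' == s) U y' x).
  transitivity (\sum_(z | f z x == s) \sum_(y' | h y y' == r) U y' z).
    rewrite [RHS]big_mkcond; apply: eq_bigr => z _; case: ifP => [fz|_]; last first.
      by rewrite big1 // => u; rewrite andbF.
    by rewrite -(matched_intertwined y z (fhb r)); apply: eq_bigl => u; rewrite andbT.
  rewrite exchange_big; apply: eq_bigr => z _ /=.
  exact: matched_intertwined z x (fhb s).
rewrite (exchange_big_dep xpredT) //=; apply: eq_bigr => u _.
by rewrite sumr_const.
Qed.

Lemma edge_matched : matched (edge G) (edge H).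
Proof.
move=> x x' y y' nz.
suff /(_ _ _ _ _ nz) :
    matched (fun u v => edge G u v : nat) (fun u v => edge H u v : nat).
  by do 2 case: edge.
apply: intertwined_matched => {nz}y {}x.
transitivity (matmul U (@adj R A G) y x).
  by apply: eq_bigr => u _; rewrite /adj mulr_natr.
by rewrite U_adj; apply: eq_bigr => u _; rewrite /adj mulr_natl.
Qed.

Let swap_nz x x' y y' : U y x * U y' x' != 0 -> U y' x' * U y x != 0.
Proof.
apply: contra_neq => eq0.
rewrite -(star0 A) -eq0 star_mul.
by rewrite (proj1 (U_proj y x)) (proj1 (U_proj y' x')).
Qed.

Lemma quantum_strategy : pebble_equivalent G H.
Proof.
(* The position reached is the class of a pair under the equivalence generated  *)
(* by non-orthogonality; its counts are matched, hence determine a bijection.   *)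
pose T : finType := ((G * G) + (H * H))%type.
pose link : rel T := fun s t => match s, t with
  | inl u, inr v | inr v, inl u => U v.1 u.1 * U v.2 u.2 != 0
  | _, _ => false end.
have link_sym : symmetric link by move=> [u|v] [u'|v'].
have link_connect : connect_sym link by apply: sym_connect_sym.
pose f x x' := fingraph.root link (inl (x, x')).
pose h y y' := fingraph.root link (inr (y, y')).
have fh : matched f h.
  by move=> x x' y y' nz; apply/eqP; rewrite root_connect // connect1.
(* Matched data are constant along links, hence on each class. *)
have same W (f' : G -> G -> W) (h' : H -> H -> W) x x' y y' :
    matched f' h' -> f x x' = h y y' -> f' x x' = h' y y'.
  move=> fh' /eqP; rewrite root_connect //.
  pose F (t : T) := match t with inl u => f' u.1 u.2 | inr v => h' v.1 v.2 end.
  have F_path p : forall t, path link t p -> F t = F (last t p).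
    elim: p => //= t p IH u /andP[ut pt]; rewrite -IH //.
    by case: u t ut {IH pt} => [[? ?]|[? ?]] [[? ?]|[? ?]] //= /fh'.
  by move=> /connectP[p pth lp]; exact: etrans (F_path _ _ pth) (congr1 F (esym lp)).
exists (fun x x' y y' => f x x' = h y y'); split.
- move=> x x' y y'; apply: same => {}x {}x' {}y {}y' nz; apply/idP/idP => /eqP eq.
    by apply: contraNT nz; rewrite eq => ne; rewrite U_col_orth.
  by apply: contraNT nz; rewrite eq => ne; rewrite U_row_orth.
- by move=> x x' y y'; apply: same edge_matched.
- move=> x x' y y'; apply: (@same _ (fun x x' => f x' x) (fun y y' => h y' y)).
  by move=> {}x {}x' {}y {}y' /swap_nz /fh.
- move=> x x' y y' xy.
  have [|g g_bij hg] := @fiber_bijection G H _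
      (fun z => (f x z, f z x')) (fun z => (h y z, h z y')) x y.
    move=> [r s]; have := same _ _ _ _ _ _ _ (matched_count r s fh) xy; rewrite /= => eq.
    transitivity #|[pred z | (f x z == r) && (f z x' == s)]|; first exact: eq_card.
    by rewrite eq; apply: eq_card.
  by exists g => // z; case: (hg z).
- have /card_gt0P[x _] := vertex_gt0 G; case: (pickP (fun y => U y x != 0)) => [y nz|z].
    by exists x, y; apply: fh; rewrite U_idem.
  have := U_col x; rewrite big1 => [/esym/eqP|y _]; first by rewrite oner_eq0.
  by apply/eqP; move: (z y) => /negbFE.
Qed.

End QuantumStrategy.

(** * Components, complements and embeddings *)

Lemma isomorphic_refl (G : graph) : isomorphic G G.
Proof. by exists id => //; exists id. Qed.

Lemma isomorphic_sym (G H : graph) : isomorphic G H -> isomorphic H G.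
Proof.
move=> [f [f' fK f'K] fE]; exists f'; first by exists f.
by move=> x y; rewrite -fE !f'K.
Qed.

Lemma isomorphic_trans (G H K : graph) :
  isomorphic G H -> isomorphic H K -> isomorphic G K.
Proof.
move=> [f f_bij fE] [g g_bij gE]; exists (g \o f); first exact: bij_comp.
by move=> x y; rewrite /= gE fE.
Qed.

Lemma isomorphic_card (G H : graph) : isomorphic G H -> #|G| = #|H|.
Proof. by case=> f /bij_eq_card. Qed.

Lemma edge_connect_sym (G : graph) : connect_sym (edge G).
Proof. exact/sym_connect_sym/edge_sym. Qed.

Section Component.
Variables (G : graph) (x : G).

Definition component_vertex : finType := {z : G | connect (edge G) x z}.

Definition component_edge : rel component_vertex :=
  fun u v => edge G (val u) (val v).

Lemma component_edge_sym : symmetric component_edge.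
Proof. by move=> u v; apply: edge_sym. Qed.

Lemma component_edge_irr : irreflexive component_edge.
Proof. by move=> u; apply: edge_irr. Qed.

Lemma component_vertex_gt0 : (0 < #|component_vertex|)%N.
Proof. by apply/card_gt0P; exists (exist _ x (connect0 _ _)). Qed.

Definition component : graph :=
  Graph component_edge_sym component_edge_irr component_vertex_gt0.

Lemma card_component : #|component| = #|connect (edge G) x|.
Proof. by rewrite /= card_sig; apply: eq_card. Qed.

End Component.

(** A total function, with junk value [y] off the component, keeps dependent types out of the
    gluing. *)
Lemma component_isoE (G H : graph) (x : G) (y : H) :
  isomorphic (component x) (component y) ->
  exists f : G -> H,
    [/\ forall u, connect (edge G) x u -> connect (edge H) y (f u),
        {in connect (edge G) x &, injective f}
      & {in connect (edge G) x &, forall u v, edge H (f u) (f v) = edge G u v}].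
Proof.
move=> [i /bij_inj i_inj iE].
pose f u := if insub u is Some u' then val (i u') else y.
have fE u (xu : connect (edge G) x u) : f u = val (i (exist _ u xu)).
  by rewrite /f insubT.
exists f; split=> [u xu|u v xu xv|u v xu xv].
- by rewrite (fE u xu); apply: valP.
- by rewrite (fE u xu) (fE v xv) => /val_inj/i_inj[].
- by rewrite (fE u xu) (fE v xv); apply: iE.
Qed.

Lemma connect_component_iso (K : graph) (x y : K) :
  connect (edge K) x y -> isomorphic (component x) (component y).
Proof.
move=> xy; have sub a b : connect (edge K) a b -> forall u : component a,
    connect (edge K) b (val u).
  move=> ab u; rewrite -(same_connect (@edge_connect_sym K) ab); exact: (valP u).
have yx : connect (edge K) y x by rewrite edge_connect_sym.
exists (fun u => exist _ (val u) (sub x y xy u)) => //.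
by exists (fun v => exist _ (val v) (sub y x yx v)) => u; apply: val_inj.
Qed.

Definition component_root (K : graph) (x : K) : {x : K | roots (edge K) x} :=
  exist _ (fingraph.root (edge K) x) (roots_root (@edge_connect_sym K) x).

Lemma component_root_eq (K : graph) (x y : K) :
  (component_root x == component_root y) = connect (edge K) x y.
Proof. by rewrite -val_eqE /= root_connect //; apply: edge_connect_sym. Qed.

Lemma val_component_root (K : graph) (s : {x : K | roots (edge K) x}) :
  component_root (val s) = s.
Proof. by apply/val_inj/eqP; apply: (valP s). Qed.

Lemma card_fiber_roots (K : graph) (C : eqType) (c : K -> C) (k : C) (m : nat) :
  (forall x y, connect (edge K) x y -> c x = c y) ->
  (forall x, c x = k -> #|connect (edge K) x| = m) ->
  #|[pred x | c x == k]| =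
    (#|[pred s : {x : K | roots (edge K) x} | c (val s) == k]| * m)%N.
Proof.
move=> c_conn c_card; rewrite -sum1_card.
rewrite (partition_big (@component_root K) (fun s => c (val s) == k)); last first.
  move=> x /eqP <-; apply/eqP/esym/c_conn.
  by rewrite -component_root_eq val_component_root.
rewrite -sum_nat_const; apply: eq_bigr => s /eqP cs; rewrite sum1_card.
rewrite -(c_card _ cs); apply: eq_card => x.
rewrite unfold_in /= -{1}(val_component_root s) component_root_eq edge_connect_sym.
apply: andb_idl => sx; rewrite -cs; apply/eqP/esym/c_conn; exact: sx.
Qed.

Section GlueComponents.
Variables (G H : graph) (g : G -> H).
Hypothesis g_bij : bijective g.
Hypothesis g_iso : forall x, isomorphic (component x) (component (g x)).

(* Equality of kinds encodes isomorphism of components.                         *)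
Let kind (y : H) : option H :=
  [pick y' | `[< isomorphic (component y) (component y') >]].

Let kindP y y' : reflect (isomorphic (component y) (component y')) (kind y == kind y').
Proof.
apply: (iffP eqP) => [|iso].
  rewrite /kind; case: pickP => [w /asboolP yw|/(_ y)]; last first.
    by move/asboolP; case; apply: isomorphic_refl.
  case: pickP => // w' /asboolP yw' [eq_w]; subst w'.
  exact: isomorphic_trans yw (isomorphic_sym yw').
apply: eq_pick => w; apply/asboolP/asboolP; apply: isomorphic_trans => //.
exact: isomorphic_sym.
Qed.

(** [g] shows that components of each isomorphism type cover equally many vertices in [G] and [H].
    Dividing by their common size, the components are equinumerous and can be paired off. *)
Lemma isomorphic_glue_components : isomorphic G H.
Proof.
have [x0 _] : exists x : G, x \in G by apply/card_gt0P/vertex_gt0.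
have kind_conn y y' : connect (edge H) y y' -> kind y = kind y'.
  by move=> /connect_component_iso /kindP/eqP.
(* The value at [None], which is no vertex's kind, only keeps [m] positive for the division. *)
pose m k := if k is Some y then #|connect (edge H) y| else 1%N.
have kind_card y k : kind y = k -> #|connect (edge H) y| = m k.
  rewrite /kind; case: pickP => [w /asboolP iso <-|/(_ y)].
    by rewrite /= -!card_component; apply: isomorphic_card.
  by move/asboolP; case; apply: isomorphic_refl.
have m_gt0 k : (0 < m k)%N.
  by case: k => //= y; apply/card_gt0P; exists y; apply: connect0.
have [|sg sg_bij sg_kind] := @fiber_bijection _ _ _
    (fun s : {x : G | roots (edge G) x} => kind (g (val s)))
    (fun t : {y : H | roots (edge H) y} => kind (val t))
    (component_root x0) (component_root (g x0)).
  move=> k; apply/eqP; rewrite -(eqn_pmul2r (m_gt0 k)); apply/eqP.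
  rewrite -(card_fiber_roots kind_conn (kind_card^~ k)).
  rewrite -(@card_fiber_roots _ _ (kind \o g)).
  - rewrite -(card_image (bij_inj g_bij)); apply: eq_card => y.
    have [g' _ g'K] := g_bij.
    by rewrite -(g'K y) (mem_image (bij_inj g_bij)).
  - move=> x x' /connect_component_iso iso; apply/eqP/kindP.
    exact: isomorphic_trans (isomorphic_sym (g_iso x)) (isomorphic_trans iso (g_iso x')).
  - move=> x /kind_card <-; rewrite -!card_component; exact: isomorphic_card.
have /choice[F FP] : forall s : {x : G | roots (edge G) x}, exists f : G -> H,
    [/\ forall u, connect (edge G) (val s) u -> connect (edge H) (val (sg s)) (f u),
        {in connect (edge G) (val s) &, injective f}
      & {in connect (edge G) (val s) &, forall u v, edge H (f u) (f v) = edge G u v}].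
  move=> s; apply: component_isoE; apply: isomorphic_trans (g_iso _) _.
  by apply/kindP; rewrite sg_kind.
pose phi x := F (component_root x) x.
have rootx x : connect (edge G) (val (component_root x)) x.
  by rewrite -component_root_eq val_component_root.
have phi_root x : component_root (phi x) = sg (component_root x).
  rewrite -[RHS]val_component_root; apply/esym/eqP; rewrite component_root_eq.
  by case: (FP (component_root x)) => + _ _; apply; apply: rootx.
have phi_conn x x' : connect (edge H) (phi x) (phi x') ->
    component_root x = component_root x'.
  rewrite -component_root_eq !phi_root => /eqP; exact: (bij_inj sg_bij).
exists phi => [|x x'].
  apply: inj_card_bij; last by rewrite (bij_eq_card g_bij).
  move=> x x' eq_phi; have /phi_conn eq_root : connect (edge H) (phi x) (phi x').
    by rewrite eq_phi.
  case: (FP (component_root x)) => _ + _; apply; rewrite ?inE.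
  - exact: rootx.
  - by rewrite eq_root; apply: rootx.
  - by rewrite -[LHS]/(phi x) eq_phi eq_root.
have [eq_root|ne_root] := eqVneq (component_root x) (component_root x').
  case: (FP (component_root x)) => _ _ /(_ x x').
  rewrite /phi -eq_root; apply; first exact: rootx.
  by rewrite eq_root; apply: rootx.
apply/idP/idP => e; case/eqP: ne_root.
  by apply: phi_conn; apply: connect1.
by apply/eqP; rewrite component_root_eq connect1.
Qed.

End GlueComponents.

(** * Strategies and connectedness *)

Section StrategyTheory.
Variables (G H : graph) (rho : G -> G -> H -> H -> Prop).
Hypothesis rho_strategy : strategy rho.

Lemma strategy_converse : strategy (fun y y' x x' => rho x x' y y').
Proof.
case: rho_strategy => s_eq s_edge s_swap s_move [x0 [y0 s0]]; split.
- by move=> y y' x x' /s_eq.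
- by move=> y y' x x' /s_edge.
- by move=> y y' x x' /s_swap.
- move=> y y' x x' /s_move[g [g' gK g'K] gP]; exists g'; first by exists g.
  by move=> z; have := gP (g' z); rewrite g'K.
- by exists y0, x0.
Qed.

(** A pebble walks along the path from [x] to [x'], and its opponent traces a walk in [H]. *)
Lemma strategy_connect_imp x x' y y' :
  rho x x' y y' -> connect (edge G) x x' -> connect (edge H) y y'.
Proof.
move=> + /connectP[p]; elim: p x y => [|z p IH] x y xy /=.
  move=> _ eq_x; have := strategy_eq rho_strategy xy.
  by rewrite eq_x eqxx => /esym/eqP ->; apply: connect0.
move=> /andP[xz zp] lp; have [g _ /(_ z)[xz' zx']] := strategy_move rho_strategy xy.
apply: connect_trans (IH _ _ zx' zp lp); apply: connect1.
by rewrite -(strategy_edge rho_strategy xz').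
Qed.

(** Pebbling [z] a second time forces the same answer, so both pebbles may stand on [z]. *)
Lemma strategy_diagonal x y : rho x x y y ->
  exists2 g : G -> H, bijective g & forall z, rho x z y (g z) /\ rho z z (g z) (g z).
Proof.
move=> /(strategy_move rho_strategy)[g g_bij gP]; exists g => // z.
split; first by case: (gP z).
have [/(strategy_move rho_strategy)[g' _ /(_ z)[_ zz]] _] := gP z.
have := strategy_eq rho_strategy zz; rewrite eqxx => /esym/eqP eq_g.
by rewrite eq_g in zz.
Qed.

End StrategyTheory.

Lemma strategy_connect (G H : graph) rho x x' y y' : @strategy G H rho ->
  rho x x' y y' -> connect (edge G) x x' = connect (edge H) y y'.
Proof.
move=> s xy; apply/idP/idP; first by apply (strategy_connect_imp s xy).
exact: (@strategy_connect_imp _ _ _ (strategy_converse s) y y' x x' xy).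
Qed.

(** Answers preserve connectedness to the pebbles, so each bijection restricts to the components. *)
Lemma pebble_equivalent_component (G H : graph) rho (x : G) (y : H) :
  strategy rho -> rho x x y y -> pebble_equivalent (component x) (component y).
Proof.
move=> s xy; exists (fun u u' v v' => rho (val u) (val u') (val v) (val v')); split.
- by move=> u u' v v' /(strategy_eq s); rewrite !val_eqE.
- by move=> u u' v v' /(strategy_edge s).
- by move=> u u' v v' /(strategy_swap s).
- move=> u u' v v' /(strategy_move s)[g [g' gK g'K] gP].
  have conn z : connect (edge G) x z = connect (edge H) y (g z).
    rewrite (same_connect (@edge_connect_sym G) (valP u)).
    rewrite (same_connect (@edge_connect_sym H) (valP v)).
    by apply: strategy_connect s _; case: (gP z).
  have g_in (w : component x) : connect (edge H) y (g (val w)).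
    by rewrite -conn; apply: (valP w).
  have g'_in (w : component y) : connect (edge G) x (g' (val w)).
    by rewrite conn g'K; apply: (valP w).
  exists (fun w : component x => exist _ (g (val w)) (g_in w)) => [|w]; last exact: gP.
  by exists (fun w : component y => exist _ (g' (val w)) (g'_in w)) => w;
    apply: val_inj; rewrite /= ?gK ?g'K.
- by exists (exist _ x (connect0 _ _)), (exist _ y (connect0 _ _)).
Qed.

(** * Rigid graphs and induced subgraphs *)

Definition rigid (G : graph) : Prop :=
  forall H : graph, pebble_equivalent G H -> isomorphic G H.

Lemma rigid_components (G : graph) :
  (forall x : G, rigid (component x)) -> rigid G.
Proof.
move=> G_rigid H [rho s]; have [x [y xy]] := strategy_start s.
have [g g_bij gP] := strategy_diagonal s xy.
apply: isomorphic_glue_components g_bij _ => z; apply: G_rigid.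
by have [_] := gP z; apply: pebble_equivalent_component.
Qed.

(** The same [rho] wins on the complements, whose edges depend only on equality and adjacency. *)
Lemma rigid_complement (G : graph) : rigid (complement G) -> rigid G.
Proof.
move=> G_rigid H [rho s]; have [|f f_bij fE] := G_rigid (complement H).
  exists rho; case: s => s_eq s_edge *; split=> // x x' y y' xy.
  by rewrite /= /compl_edge (s_eq _ _ _ _ xy) (s_edge _ _ _ _ xy).
exists f => // x y; have := fE x y; rewrite /= /compl_edge (inj_eq (bij_inj f_bij)).
have [->|_] := eqVneq x y; first by rewrite !edge_irr.
by move=> /= /negb_inj.
Qed.

Definition embeds (K G : graph) : Prop :=
  exists2 f : K -> G, injective f & forall x y, edge G (f x) (f y) = edge K x y.

Lemma embeds_refl (G : graph) : embeds G G.
Proof. by exists id. Qed.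

Lemma embeds_trans (G H K : graph) : embeds G H -> embeds H K -> embeds G K.
Proof.
move=> [f f_inj fE] [g g_inj gE]; exists (g \o f); first exact: inj_comp.
by move=> x y; rewrite /= gE fE.
Qed.

Lemma embeds_component (G : graph) (x : G) : embeds (component x) G.
Proof. by exists val => //; apply: val_inj. Qed.

Lemma embeds_complement (K G : graph) :
  embeds K G -> embeds (complement K) (complement G).
Proof.
move=> [f f_inj fE]; exists f => // x y.
by rewrite /= /compl_edge (inj_eq f_inj) fE.
Qed.

Lemma embeds_complementK (G : graph) : embeds (complement (complement G)) G.
Proof.
exists id => // x y; rewrite /= /compl_edge /= /compl_edge negb_and !negbK.
by have [->|] := eqVneq x y; rewrite ?edge_irr.
Qed.

Lemma component_embeds_summand (K : graph) (I : finType) (F : I -> graph)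
    (I_gt0 : (0 < #|I|)%N) (f : K -> disjoint_union F I_gt0) (x : K) :
  injective f -> (forall u v, edge (disjoint_union F I_gt0) (f u) (f v) = edge K u v) ->
  embeds (component x) (F (tag (f x))).
Proof.
move=> f_inj fE.
have f_tag u : connect (edge K) x u -> tag (f u) = tag (f x).
  move=> /connectP[p + ->]; elim: p x => //= z p IH x' /andP[xz zp].
  by rewrite (IH z) //; move: xz; rewrite -fE => /andP[/eqP].
pose c u := tagged_as (f x) (f u).
have cK u : connect (edge K) x u -> f u = Tagged (fun i => vertex (F i)) (c u).
  move=> /f_tag; rewrite /c; case: (f u) (f x) => [i a] [j b] /= ij; subst j.
  by rewrite tagged_asE.
exists (fun u : component x => c (val u)) => [u v eq_c|u v].
  by apply/val_inj/f_inj; rewrite (cK _ (valP u)) (cK _ (valP v)) eq_c.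
have := fE (val u) (val v); rewrite (cK _ (valP u)) (cK _ (valP v)).
by rewrite /= /du_edge /= eqxx tagged_asE.
Qed.

(** * Trees and tree-cographs *)

(** The parent is a neighbor closer to [r]; [n] is the largest distance from [r]. *)
Lemma connected_parent (G : graph) (r : G) : connected G ->
  exists (parent : G -> G) (n : nat),
    [/\ parent r = r, forall x, x != r -> edge G (parent x) x
      & forall x, iter n parent x = r].
Proof.
move=> G_conn.
pose walk n x := [exists p : n.-tuple G, path (edge G) r p && (last r p == x)].
have walk_ex x : exists n, walk n x.
  have /connectP[p rp ->] := G_conn r x; exists (size p).
  by apply/existsP; exists (in_tuple p); rewrite rp /=.
pose d x := ex_minn (walk_ex x).
have closer x : exists z, x != r -> edge G z x && (d z < d x)%N.
  have [->|xr] := eqVneq x r; first by exists r.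
  rewrite {2}/d; case: ex_minnP => n /existsP[[p /= /eqP sp] /andP[rp /eqP lp]] _.
  case/lastP: p sp rp lp => [|p z]; first by move=> _ _ /= xr'; rewrite xr' eqxx in xr.
  rewrite size_rcons last_rcons rcons_path => <- /andP[rp pz] <-.
  exists (last r p) => _; rewrite pz /= /d; case: ex_minnP => m _; apply.
  by apply/existsP; exists (in_tuple p); rewrite rp /=.
have [f fP] := choice closer.
exists (fun x => if x == r then r else f x), (\max_x d x)%N; split.
- by rewrite eqxx.
- by move=> x xr; rewrite (negPf xr); case/andP: (fP x xr).
move=> x; elim: (\max_x d x)%N x (@leq_bigmax _ d x) => [|n IH] x.
  rewrite leqn0 /=; have [//|/fP/andP[_ lt]] := eqVneq x r.
  by move=> /eqP d0; rewrite d0 in lt.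
rewrite iterSr; have [->|/fP/andP[_ lt]] := eqVneq x r => le.
  by elim: n {IH le} => //= n ->; rewrite eqxx.
by apply: IH; rewrite -ltnS; apply: leq_trans lt le.
Qed.

(* Otherwise the edge would close a cycle with the path of parent links.        *)
Lemma acyclic_parent (G : graph) (parent : G -> G) (r : G) (n : nat) :
  acyclic G -> parent r = r -> (forall x, x != r -> edge G (parent x) x) ->
  (forall x, iter n parent x = r) ->
  forall x z, edge G x z -> parent z = x \/ parent x = z.
Proof.
move=> G_acyclic parent_r parent_edge parent_iter x z xz.
pose e u v := edge G u v && ((parent u == v) || (parent v == u)).
have e_sym : symmetric e by move=> u v; rewrite /e edge_sym orbC.
have e_root u : connect e u r.
  rewrite -(parent_iter u); elim: n {parent_iter} => [|m IH] //=.
  apply: connect_trans IH _; set v := iter m parent u.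
  have [->|/parent_edge vE] := eqVneq v r; first by rewrite parent_r.
  by apply: connect1; rewrite /e edge_sym vE eqxx.
have /connectP[p] : connect e x z.
  by apply: connect_trans (e_root x) _; rewrite (sym_connect_sym e_sym).
case/shortenP=> {}p xp p_uniq _ zp.
have : (size (x :: p) <= 2)%N.
  apply: G_acyclic; rewrite /ucycle p_uniq andbT /= rcons_path -zp edge_sym xz andbT.
  by apply: sub_path xp => u v /andP[].
case: p xp p_uniq zp => [|w [|//]] /=; first by move=> _ _ zx; rewrite zx edge_irr in xz.
by move=> /andP[/andP[_ /orP[] /eqP]] + _ _ -> _; [right | left].
Qed.

(** Answers followed outward from the root define [phi], which preserves edges and lifts them. It is
    onto since [H] is connected, hence bijective by cardinality, and lifting then makes it reflect
    edges. *)
Lemma tree_rigid (G : graph) : is_tree G -> rigid G.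
Proof.
move=> [G_conn G_acyclic] H [rho s]; have [r [y0 ry0]] := strategy_start s.
have [parent [n [parent_r parent_edge parent_iter]]] := connected_parent r G_conn.
have tree_edge := acyclic_parent G_acyclic parent_r parent_edge parent_iter.
have /choice[move move_spec] : forall t : G * G * H * H, exists g : G -> H,
    rho t.1.1.1 t.1.1.2 t.1.2 t.2 -> bijective g /\
    forall z, rho t.1.1.1 z t.1.2 (g z) /\ rho z t.1.1.2 (g z) t.2.
  move=> [[[x x'] y] y'].
  have [/(strategy_move s)[g g_bij gP]|no] := pselect (rho x x' y y'); first by exists g.
  by exists (fun=> y0).
(* The image of x is read off the strategy at the position of its parent and    *)
(* grandparent; iterating settles the images level by level.                    *)
pose step (f : G -> H) x :=
  move (parent (parent x), parent x, f (parent (parent x)), f (parent x)) x.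
have iter_r m : iter m step (fun=> y0) r = y0.
  elim: m => //= m IH; rewrite /step !parent_r IH.
  have [_ /(_ r)[/(strategy_eq s) + _]] := move_spec (r, r, y0, y0) ry0.
  by rewrite eqxx => /esym/eqP/esym.
(* After [m] rounds, images down to depth [m] no longer change, so [phi] is a fixed point of [step]
   everywhere. *)
have stable m x : iter m parent x = r ->
    iter m.+1 step (fun=> y0) x = iter m step (fun=> y0) x.
  elim: m x => [|m IH] x; first by move=> /= ->; exact: (iter_r 1).
  rewrite iterSr => xr.
  have xr' : iter m parent (parent (parent x)) = r by rewrite -iterSr iterS xr.
  by rewrite -[LHS]/(step (iter m.+1 step (fun=> y0)) x) {1}/step (IH _ xr) (IH _ xr').
pose phi := iter n step (fun=> y0).
have phiE x : phi x = step phi x by exact: esym (stable n x (parent_iter x)).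
have phi_rho x : rho (parent x) x (phi (parent x)) (phi x).
  have : iter n parent x = r by [].
  elim: {1}n x => [|m IH] x; first by move=> /= ->; rewrite parent_r /phi iter_r.
  rewrite iterSr => /IH xr; rewrite [phi x]phiE.
  have [_ /(_ x)[_]] := move_spec (_, _, _, _) xr.
  exact: (strategy_swap s).
have phi_edge x z : edge G x z -> edge H (phi x) (phi z).
  move=> xz; case: (tree_edge _ _ xz) => e; last rewrite edge_sym.
    by rewrite -e -(strategy_edge s (phi_rho z)) e.
  by rewrite -e -(strategy_edge s (phi_rho x)) e edge_sym.
(* All children of [x] are answered by one bijection, played at [x] and its parent. The preimage of
   [y] under it is a neighbor of [x]: either a child, which [phi] sends to [y], or the parent, and
   equality is preserved. *)
have phi_lift x y : edge H (phi x) y -> exists2 z, edge G x z & phi z = y.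
  have [[g' _ gK] gP] := move_spec (_, _, _, _) (phi_rho x).
  have [] := gP (g' y); rewrite gK /= => parent_y y_x.
  rewrite edge_sym -(strategy_edge s y_x) edge_sym => xy; exists (g' y) => //.
  have [xe|ye] := tree_edge _ _ xy; last first.
    by have := strategy_eq s parent_y; rewrite ye eqxx => /esym/eqP.
  by rewrite phiE /step xe gK.
have H_conn y : connect (edge H) y0 y.
  have [g [g' _ gK] gP] := strategy_diagonal s ry0.
  have [yP _] := gP (g' y); rewrite gK in yP.
  by rewrite -(strategy_connect s yP).
have phi_surj y : exists x, phi x = y.
  have /connectP[p] := H_conn y; rewrite -(iter_r n) -/phi => rp ->.
  have lift q : forall x, path (edge H) (phi x) q -> exists x', phi x' = last (phi x) q.
    elim: q => [|w q IH] x /=; first by exists x.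
    by move=> /andP[/phi_lift[x' _ <-]]; apply: IH.
  exact: lift rp.
have [psi psiK] := choice phi_surj.
have phi_bij : bijective phi.
  have [g g_bij _] := strategy_diagonal s ry0.
  apply: bij_can_bij (psiK); apply: inj_card_bij (can_inj psiK) _.
  by rewrite (bij_eq_card g_bij).
exists phi => // x z; apply/idP/idP => [/phi_lift[z' xz']|/phi_edge //].
by move/(bij_inj phi_bij) <-.
Qed.

Lemma component_connected (G : graph) (x : G) : connected (component x).
Proof.
have root_conn (u : component x) :
    connect (edge (component x)) (exist _ x (connect0 _ _)) u.
  case: u => u xu; have /connectP[p] := xu.
  elim/last_ind: p u xu => [|p v IH] u xu /=.
    move=> _ eq_u; rewrite (_ : exist _ u xu = exist _ x (connect0 _ _)) //.
    exact: val_inj.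
  rewrite rcons_path last_rcons => /andP[xp pv] uv; subst u.
  have xl : connect (edge G) x (last x p) by apply/connectP; exists p.
  by apply: connect_trans (IH _ xl xp erefl) _; apply: connect1.
move=> u v; apply: connect_trans (root_conn v).
by rewrite edge_connect_sym.
Qed.

Lemma embeds_acyclic (K G : graph) : embeds K G -> acyclic G -> acyclic K.
Proof.
move=> [f f_inj fE] G_acyclic c /andP[c_cycle c_uniq].
rewrite -(size_map f); apply: G_acyclic; rewrite /ucycle map_inj_uniq // c_uniq andbT.
by rewrite cycle_map; apply: sub_cycle c_cycle => x y; rewrite /= fE.
Qed.

Lemma isomorphic_embeds (G H : graph) : isomorphic G H -> embeds H G.
Proof. by move/isomorphic_sym => [f /bij_inj f_inj fE]; exists f. Qed.

(** Induced subgraphs of trees have trees as components, those of disjoint unions have components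
    inside a summand, and those of a complement have complements embedding in the original graph. *)
Lemma tree_cograph_embeds_rigid (G : graph) : tree_cograph G ->
  forall K, embeds K G -> rigid K.
Proof.
elim=> {G} [G [_ G_acyclic]|I F I_gt0 _ IH|G _ IH|G H GH _ IH] K.
- move=> KG; apply: rigid_components => x; apply: tree_rigid.
  split; first exact: component_connected.
  exact: embeds_acyclic (embeds_trans (embeds_component x) KG) G_acyclic.
- move=> [f f_inj fE]; apply: rigid_components => x.
  exact: IH _ _ (component_embeds_summand x f_inj fE).
- move=> KG; apply/rigid_complement/IH.
  exact: embeds_trans (embeds_complement KG) (embeds_complementK G).
- by move=> KH; apply/IH/(embeds_trans KH)/isomorphic_embeds.
Qed.

Theorem corollary6p25 (R : realType) : superrigid R tree_cograph.
Proof.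
move=> G H G_tree [_ [A [U [U_magic U_adj]]]]; apply: isomorphic_sym.
apply: (tree_cograph_embeds_rigid G_tree (embeds_refl G)).
exact: quantum_strategy U_magic U_adj.
Qed.
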